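(* Let $M=(X,d)$ be a metric space and let $P=\{P_i\}_{i=1}^t$ be a temporal-sampling of $M$ of size $n$. Suppose that $P$ admits a local $(\chi,\delta)$-temporal hierarchical clustering for some $\chi,\delta\in\mathbb{R}_{\geq 0}$. Then there exists an $O(n^2)$-time algorithm which returns a local $(\chi,\delta)$-temporal hierarchical clustering of $P$.
   Context: A temporal-sampling of a metric space $M=(X,d)$ of length $t$ is a sequence $P=\{P_i\}_{i=1}^t$ of finite, non-empty subsets of $X$; its size is $\sum_{i=1}^t |P_i|$. For $Q\subseteq X$, $M[Q]=(Q,d|_Q)$ denotes the restriction of $M$ to $Q$. A pseudometric $\mu$ on a set $Y$ is a pseudo-ultrametric if $\mu(u,v)\le \max\{\mu(u,w),\mu(w,v)\}$ for all $u,v,w\in Y$. For two pseudometric spaces $U=(Y,d_U)$, $V=(Y,d_V)$ on the same finite set, $L^\infty(U,V)=\max_{p,p'\in Y}|d_U(p,p')-d_V(p,p')|$. A correspondence between sets $A$ and $B$ is a relation $\mathcal{C}\subseteq A\times B$ whose projections to $A$ and to $B$ are surjective; $\mathrm{corr}(A,B)$ denotes the set of such correspondences. A local $(\chi,\delta)$-temporal hierarchical clustering of $P$ consists of pseudo-ultrametric spaces $U_i=(P_i,\mu_i)$, $i\in[t]$, with $L^\infty(M[P_i],U_i)\le\chi$ for all $i$, together with correspondences $\mathcal{C}_i\in\mathrm{corr}(P_i,P_{i+1})$, $i\in[t-1]$, such that $\max_{(u,v)\in\mathcal{C}_i} d(u,v)\le\delta$ for all $i$. The algorithm has access to the ambient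 distances $d$ between input points. *)

(* Defs.v *)
(* MathComp / MathComp-Analysis. *)
From mathcomp Require Import all_boot all_order all_algebra finmap.
From mathcomp Require Import all_classical all_reals all_analysis.

Set Implicit Arguments.
Unset Strict Implicit.
Unset Printing Implicit Defensive.

Import Order.TTheory GRing.Theory Num.Theory.
Local Open Scope fset_scope.
Local Open Scope ring_scope.

(* A sequence P_1, ..., P_t is the list [P], so P_i is [P`_(i-1)]: time indices
   start at 0 and [size P] is t. *)
Section TemporalClustering.
Variables (R : realType) (X : metricType R).
Implicit Types (A B : {fset X}) (P : seq {fset X}) (mu : X -> X -> R)
  (C : {fset X * X}).

(* A sampling has length at least 1. *)
Definition temporal_sampling P : Prop :=
  (0 < size P)%N /\ forall A, A \in P -> A != fset0.

Definition sampling_size P : nat := (\sum_(A <- P) #|` A|)%N.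

(* A pseudometric on A is a function on X of which only the values on A x A
   are looked at. *)
Definition pseudometric_on A mu : Prop :=
  [/\ {in A &, forall u v, 0 <= mu u v},
      {in A, forall u, mu u u = 0},
      {in A &, forall u v, mu u v = mu v u} &
      {in A & &, forall u v w, mu u v <= mu u w + mu w v}].

Definition pseudo_ultrametric_on A mu : Prop :=
  pseudometric_on A mu /\
  {in A & &, forall u v w, mu u v <= Num.max (mu u w) (mu w v)}.

(* The maxima of nonnegative reals are taken with default value 0. *)
Definition Linfty A (d1 d2 : X -> X -> R) : R :=
  \big[Num.max/0]_(p <- A) \big[Num.max/0]_(q <- A) `|d1 p q - d2 p q|.

Definition correspondence A B C : Prop :=
  [/\ C `<=` A `*` B,
      {in A, forall u, exists v, (u, v) \in C} &
      {in B, forall v, exists u, (u, v) \in C}].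

Definition corr_width C : R := \big[Num.max/0]_(uv <- C) mdist uv.1 uv.2.

Definition local_clustering P (chi delta : R)
    (mu : nat -> X -> X -> R) (C : nat -> {fset X * X}) : Prop :=
  (forall i, (i < size P)%N ->
     pseudo_ultrametric_on (nth fset0 P i) (mu i) /\
     Linfty (nth fset0 P i) (@mdist R X) (mu i) <= chi) /\
  (forall i, (i.+1 < size P)%N ->
     correspondence (nth fset0 P i) (nth fset0 P i.+1) (C i) /\
     corr_width (C i) <= delta).

End TemporalClustering.

(* The model of computation is a real RAM, programmed in a structured language.
   The memory has two sorts of cells, holding natural numbers and reals; the
   cells of either sort form banks, indexed by nat, and each bank is an
   unbounded array. A program names finitely many banks, by literals, and
   addresses computed at run time select a cell inside a bank. There is no
   multiplication of naturals and no conversion between naturals and reals. *)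
Inductive nexp :=
| NLit of nat
| NGet of nat & nexp          (* bank, address *)
| NAdd of nexp & nexp
| NSub of nexp & nexp.        (* truncated *)

Inductive rexp :=
| RLit of nat
| RGet of nat & nexp          (* bank, address *)
| RDist of nexp & nexp        (* query to the distance oracle *)
| RAdd of rexp & rexp
| RSub of rexp & rexp
| RMul of rexp & rexp
| RDiv of rexp & rexp.        (* x / 0 is 0 *)

Inductive bexp :=
| NLe of nexp & nexp
| RLe of rexp & rexp
| BNot of bexp
| BAnd of bexp & bexp.

Inductive cmd :=
| CSkip
| CSeq of cmd & cmd
| CNSet of nat & nexp & nexp  (* bank, address, value *)
| CRSet of nat & nexp & rexp  (* bank, address, value *)
| CIf of bexp & cmd & cmd
| CWhile of bexp & cmd.

(* Evaluating an expression costs one unit per node. *)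
Fixpoint ncost (e : nexp) : nat :=
  match e with
  | NLit _ => 1
  | NGet _ e1 => (ncost e1).+1
  | NAdd e1 e2 | NSub e1 e2 => (ncost e1 + ncost e2).+1
  end.

Fixpoint rcost (e : rexp) : nat :=
  match e with
  | RLit _ => 1
  | RGet _ e1 => (ncost e1).+1
  | RDist e1 e2 => (ncost e1 + ncost e2).+1
  | RAdd e1 e2 | RSub e1 e2 | RMul e1 e2 | RDiv e1 e2 =>
      (rcost e1 + rcost e2).+1
  end.

Fixpoint bcost (b : bexp) : nat :=
  match b with
  | NLe e1 e2 => (ncost e1 + ncost e2).+1
  | RLe e1 e2 => (rcost e1 + rcost e2).+1
  | BNot b1 => (bcost b1).+1
  | BAnd b1 b2 => (bcost b1 + bcost b2).+1
  end.

Record state (R : realType) := State {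
  nmem : nat -> nat -> nat;
  rmem : nat -> nat -> R }.

Definition upd (T : Type) (m : nat -> nat -> T) (k a : nat) (v : T) :=
  fun k' a' => if (k' == k) && (a' == a) then v else m k' a'.

Section Semantics.
Variables (R : realType) (dist : nat -> nat -> R).
Implicit Types s : state R.

Fixpoint neval s (e : nexp) : nat :=
  match e with
  | NLit c => c
  | NGet k e1 => nmem s k (neval s e1)
  | NAdd e1 e2 => (neval s e1 + neval s e2)%N
  | NSub e1 e2 => (neval s e1 - neval s e2)%N
  end.

Fixpoint reval s (e : rexp) : R :=
  match e with
  | RLit c => c%:R
  | RGet k e1 => rmem s k (neval s e1)
  | RDist e1 e2 => dist (neval s e1) (neval s e2)
  | RAdd e1 e2 => reval s e1 + reval s e2
  | RSub e1 e2 => reval s e1 - reval s e2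
  | RMul e1 e2 => reval s e1 * reval s e2
  | RDiv e1 e2 => reval s e1 / reval s e2
  end.

Fixpoint beval s (b : bexp) : bool :=
  match b with
  | NLe e1 e2 => (neval s e1 <= neval s e2)%N
  | RLe e1 e2 => reval s e1 <= reval s e2
  | BNot b1 => ~~ beval s b1
  | BAnd b1 b2 => beval s b1 && beval s b2
  end.

(* [exec c s k s']: started in s, the program c halts in s' after k steps. *)
Inductive exec : cmd -> state R -> nat -> state R -> Prop :=
| exec_skip s : exec CSkip s 1 s
| exec_seq c1 c2 s s1 s2 k1 k2 :
    exec c1 s k1 s1 -> exec c2 s1 k2 s2 ->
    exec (CSeq c1 c2) s (k1 + k2) s2
| exec_nset k a e s :
    exec (CNSet k a e) s (ncost a + ncost e).+1
      (State (upd (nmem s) k (neval s a) (neval s e)) (rmem s))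
| exec_rset k a e s :
    exec (CRSet k a e) s (ncost a + rcost e).+1
      (State (nmem s) (upd (rmem s) k (neval s a) (reval s e)))
| exec_if b c1 c2 s s1 k :
    exec (if beval s b then c1 else c2) s k s1 ->
    exec (CIf b c1 c2) s (bcost b + k) s1
| exec_while_done b c s :
    ~~ beval s b -> exec (CWhile b c) s (bcost b) s
| exec_while_step b c s s1 s2 k1 k2 :
    beval s b -> exec c s k1 s1 -> exec (CWhile b c) s1 k2 s2 ->
    exec (CWhile b c) s (bcost b + k1 + k2) s2.

Lemma exec_det c s k s' : exec c s k s' ->
  forall l s'', exec c s l s'' -> l = k /\ s'' = s'.
Proof.
elim=> {c s k s'}.
- by move=> s l s'' H; inversion H; subst.
- move=> c1 c2 s s1 s2 k1 k2 _ IH1 _ IH2 l s'' H; inversion H; subst.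
  match goal with H1 : exec c1 s _ _ |- _ => have [? ?] := IH1 _ _ H1 end.
  subst.
  by match goal with H2 : exec c2 s1 _ _ |- _ => have [-> ->] := IH2 _ _ H2 end.
- by move=> k a e s l s'' H; inversion H; subst.
- by move=> k a e s l s'' H; inversion H; subst.
- move=> b c1 c2 s s1 k _ IH l s'' H; inversion H; subst.
  by match goal with H1 : exec _ s _ s'' |- _ => have [-> ->] := IH _ _ H1 end.
- move=> b c s Hb l s'' H; inversion H; subst => //.
  by match goal with H1 : is_true (beval s b) |- _ => rewrite H1 in Hb end.
- move=> b c s s1 s2 k1 k2 Hb _ IH1 _ IH2 l s'' H; inversion H; subst.
    by match goal with H1 : is_true (~~ _) |- _ => rewrite Hb in H1 end.
  match goal with H1 : exec c s _ _ |- _ => have [? ?] := IH1 _ _ H1 end.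
  subst.
  by match goal with H2 : exec (CWhile b c) s1 _ _ |- _ =>
    have [-> ->] := IH2 _ _ H2 end.
Qed.

End Semantics.

Section InputOutput.
Variables (R : realType) (X : metricType R).
Implicit Types (P : seq {fset X}) (pts : seq (seq X)).

(* The input is presented by listing each P_i without repetition, in any
   order. *)
Definition presentation P pts : Prop :=
  all uniq pts /\ [seq [fset x in s] | s <- pts] = P.

(* The entries of [flatten pts] are numbered 0, ..., n-1 and the program refers
   to points by these numbers; a point lying in several P_i has several
   numbers. *)
Definition dist_oracle pts (a b : nat) : R :=
  match onth (flatten pts) a, onth (flatten pts) b with
  | Some x, Some y => mdist x y
  | _, _ => 0
  end.

(* Natural-number bank 0 initially holds t, |P_1|, ..., |P_t|, and all the
   other cells hold 0. Neither chi nor delta is part of the input. *)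
Definition init_state pts : state R :=
  State (fun k a => if k == 0%N then nth 0%N (size pts :: shape pts) a else 0%N)
        (fun _ _ => 0).

(* The number of the occurrence of x in the i-th list. *)
Definition pt_number pts (i : nat) (x : X) : nat :=
  flatten_index (shape pts) i (index x (nth [::] pts i)).

(* Both parts of the output are tables laid out as row-major n x n matrices:
   mu_i(x, y) is read in real bank 0, and natural-number bank 1 has a nonzero
   entry exactly for the pairs in C_i. *)
Definition cell pts (a b : nat) : nat := (a * size (flatten pts) + b)%N.

Definition out_metric pts (s : state R) (i : nat) (x y : X) : R :=
  rmem s 0 (cell pts (pt_number pts i x) (pt_number pts i y)).

Definition out_corr pts P (s : state R) (i : nat) : {fset X * X} :=
  [fset uv in nth fset0 P i `*` nth fset0 P i.+1 |
     nmem s 1 (cell pts (pt_number pts i uv.1) (pt_number pts i.+1 uv.2))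
       != 0%N].

End InputOutput.

(* Main.v *)
(* Neither chi nor delta is known to the algorithm, so it returns an optimal
   solution of each of the two independent problems.

   Correspondences: matching every point with a nearest neighbour in the next
   set, and every point with a nearest neighbour in the previous one, is optimal
   for the width, since a correspondence gives each point some partner.

   Ultrametrics: let s be the single-linkage (subdominant) ultrametric of P_i,
   the minimax path distance of d. If mu is an ultrametric with |d - mu| <= chi,
   then mu <= s + chi along minimax paths, so d <= s + 2 chi; hence
   g := max (d - s) is at most 2 chi, and adding g / 2 to s off the diagonal
   gives an ultrametric at distance g / 2 <= chi from d. Prim's algorithm yields
   s in quadratic time: when v joins the tree with an edge of weight w, the
   distance s(v, u) is the maximum of w and of s(l, u), where l is the point that
   joined last. All blocks P_i are processed in one run: the cheapest
   point overall is also the cheapest of its own block. *)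
Require Import Defs.
From mathcomp Require Import all_boot all_order all_algebra finmap.
From mathcomp Require Import all_classical all_reals all_analysis.
From mathcomp Require Import zify lra.

Set Implicit Arguments.
Unset Strict Implicit.
Unset Printing Implicit Defensive.

Import Order.TTheory GRing.Theory Num.Theory.
Local Open Scope ring_scope.

(** * Program logic *)

(* A bound for the cost of [c] when each while loop makes at most [n] rounds. *)
Fixpoint cmd_cost (n : nat) (c : cmd) : nat :=
  match c with
  | CSkip => 1
  | CSeq c1 c2 => cmd_cost n c1 + cmd_cost n c2
  | CNSet _ a e => (ncost a + ncost e).+1
  | CRSet _ a e => (ncost a + rcost e).+1
  | CIf b c1 c2 => bcost b + (cmd_cost n c1 + cmd_cost n c2)
  | CWhile b c1 => bcost b + n * (bcost b + cmd_cost n c1)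
  end.

Fixpoint loop_depth (c : cmd) : nat :=
  match c with
  | CSeq c1 c2 | CIf _ c1 c2 => maxn (loop_depth c1) (loop_depth c2)
  | CWhile _ c1 => (loop_depth c1).+1
  | _ => 0
  end.

(** Each level of loop nesting costs at most one factor [n], and all other costs are absorbed
    because [n ^ d] is positive. The constant is the cost for one round per loop. *)
Lemma cmd_cost_poly n c d : (0 < n)%N -> (loop_depth c <= d)%N ->
  (cmd_cost n c <= cmd_cost 1 c * n ^ d)%N.
Proof.
move=> n0; elim: c d => [|c1 IH1 c2 IH2|k a e|k a e|b c1 IH1 c2 IH2|b c IH] d /=;
  have nd : (0 < n ^ d)%N by rewrite expn_gt0 n0.
- by rewrite mul1n.
- by rewrite geq_max => /andP[/IH1 ? /IH2 ?]; rewrite mulnDl leq_add.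
- by move=> _; rewrite leq_pmulr.
- by move=> _; rewrite leq_pmulr.
- by rewrite geq_max => /andP[/IH1 ? /IH2 ?]; rewrite !mulnDl !leq_add// leq_pmulr.
- case: d nd => // d nd; rewrite ltnS => /IH H.
  rewrite mul1n !mulnDl leq_add ?leq_pmulr//.
  rewrite mulnDr leq_add//; first by rewrite mulnC leq_mul// expnS leq_pmulr// expn_gt0 n0.
  by rewrite expnS mulnCA leq_mul.
Qed.

(** Only banks that are written count, so the preservation of all other memory can be read off the
    syntax. *)
Fixpoint nbanks (c : cmd) : seq nat :=
  match c with
  | CSeq c1 c2 | CIf _ c1 c2 => nbanks c1 ++ nbanks c2
  | CNSet k _ _ => [:: k]
  | CWhile _ c1 => nbanks c1
  | _ => [::]
  end.

Fixpoint rbanks (c : cmd) : seq nat :=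
  match c with
  | CSeq c1 c2 | CIf _ c1 c2 => rbanks c1 ++ rbanks c2
  | CRSet k _ _ => [:: k]
  | CWhile _ c1 => rbanks c1
  | _ => [::]
  end.

Definition nvar (k : nat) : nexp := NGet k (NLit 0).

Definition cfor (k : nat) (e : nexp) (c : cmd) : cmd :=
  CSeq (CNSet k (NLit 0) (NLit 0))
    (CWhile (NLe (NAdd (nvar k) (NLit 1)) e)
       (CSeq c (CNSet k (NLit 0) (NAdd (nvar k) (NLit 1))))).

Section ProgramLogic.
Variables (R : realType) (dist : nat -> nat -> R) (n : nat).
Implicit Types (s : state R) (c : cmd) (Q : state R -> Prop).

Definition frame c s s' : Prop :=
  (forall k, k \notin nbanks c -> nmem s' k = nmem s k) /\
  (forall k, k \notin rbanks c -> rmem s' k = rmem s k).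

Lemma frame_refl c s : frame c s s.
Proof. by []. Qed.

Lemma frame_trans c s1 s2 s3 : frame c s1 s2 -> frame c s2 s3 -> frame c s1 s3.
Proof.
by move=> [N1 R1] [N2 R2]; split=> k kc; [rewrite N2// N1 | rewrite R2// R1].
Qed.

Lemma frame_sub c c' s s' :
  {subset nbanks c <= nbanks c'} -> {subset rbanks c <= rbanks c'} ->
  frame c s s' -> frame c' s s'.
Proof.
by move=> cn cr [N1 R1]; split=> k kc;
  [apply: N1; apply: contra kc => /cn | apply: R1; apply: contra kc => /cr].
Qed.

Lemma upd_neq (T : Type) (m : nat -> nat -> T) k a v k' :
  k' != k -> upd m k a v k' = m k'.
Proof. by move=> kk; apply/funext => a'; rewrite /upd (negbTE kk). Qed.

Lemma exec_frame c s k s' : exec dist c s k s' -> frame c s s'.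
Proof.
elim=> {c s k s'} //.
- move=> c1 c2 s s1 s2 k1 k2 _ F1 _ F2; apply: (@frame_trans _ _ s1).
    by apply: frame_sub F1 => x; rewrite /= mem_cat => ->.
  by apply: frame_sub F2 => x; rewrite /= mem_cat => ->; rewrite orbT.
- by move=> k a e s; split=> k' //; rewrite inE => kk; rewrite /= upd_neq.
- by move=> k a e s; split=> k' //; rewrite inE => kk; rewrite /= upd_neq.
- move=> b c1 c2 s s1 k _; case: ifP => _; apply: frame_sub => x;
  by rewrite /= mem_cat => ->; rewrite ?orbT.
- by move=> b c s s1 s2 k1 k2 _ _ F1 _ F2; apply: frame_trans F1 F2.
Qed.

(** Total correctness with a cost: halting, the bound on the steps and the postcondition travel
    together, so the running time needs no separate analysis. [n] caps the rounds of every loop. *)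
Definition wp c s Q : Prop :=
  exists k s', [/\ exec dist c s k s', (k <= cmd_cost n c)%N & Q s'].

(** The frame comes for free from the execution, so specifications need not mention banks that [c]
    does not write. *)
Lemma wp_conseq c s Q Q' :
  wp c s Q -> (forall s', frame c s s' -> Q s' -> Q' s') -> wp c s Q'.
Proof.
move=> [k [s' [E K q]]] QQ'; exists k, s'; split=> //.
exact: QQ' (exec_frame E) q.
Qed.

Lemma wp_skip s Q : Q s -> wp CSkip s Q.
Proof. by move=> q; exists 1%N, s; split=> //; constructor. Qed.

Lemma wp_seq c1 c2 s Q : wp c1 s (fun s1 => wp c2 s1 Q) -> wp (CSeq c1 c2) s Q.
Proof.
move=> [k1 [s1 [E1 K1 [k2 [s2 [E2 K2 q]]]]]].
exists (k1 + k2)%N, s2; split=> //; first exact: exec_seq E1 E2.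
by rewrite leq_add.
Qed.

Lemma wp_nset k a e s Q :
  Q (State (upd (nmem s) k (neval s a) (neval s e)) (rmem s)) ->
  wp (CNSet k a e) s Q.
Proof. by move=> q; do 2 eexists; split; [exact: exec_nset | |exact: q]. Qed.

Lemma wp_rset k a e s Q :
  Q (State (nmem s) (upd (rmem s) k (neval s a) (reval dist s e))) ->
  wp (CRSet k a e) s Q.
Proof. by move=> q; do 2 eexists; split; [exact: exec_rset | |exact: q]. Qed.

Lemma wp_if b c1 c2 s Q :
  (beval dist s b -> wp c1 s Q) -> (~~ beval dist s b -> wp c2 s Q) ->
  wp (CIf b c1 c2) s Q.
Proof.
move=> H1 H2.
suff [k [s' [E K q]]] : exists k s',
    [/\ exec dist (if beval dist s b then c1 else c2) s k s',
        (k <= cmd_cost n c1 + cmd_cost n c2)%N & Q s'].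
  by exists (bcost b + k)%N, s'; split=> //; [exact: exec_if|rewrite leq_add2l].
case: ifP H1 H2 => _ H1 H2.
  have [k [s' [? ? ?]]] := H1 isT; exists k, s'; split=> //; lia.
have [k [s' [? ? ?]]] := H2 isT; exists k, s'; split=> //; lia.
Qed.

(** [I j] holds after [j] rounds. The loop itself writes the counter between rounds, so [I] must be
    insensitive to that cell; the bound [e] is re-evaluated each time, so it must keep the value
    [m]. *)
Lemma wp_for (k : nat) e c (I : nat -> state R -> Prop) m s Q :
  (m <= n)%N -> k \notin nbanks c ->
  (forall j s' v, I j s' -> I j (State (upd (nmem s') k 0 v) (rmem s'))) ->
  (forall s', frame (cfor k e c) s s' -> neval s' e = m) ->
  I 0%N s ->
  (forall j s', (j < m)%N -> frame (cfor k e c) s s' -> nmem s' k 0%N = j ->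
     I j s' -> wp c s' (I j.+1)) ->
  (forall s', frame (cfor k e c) s s' -> I m s' -> Q s') ->
  wp (cfor k e c) s Q.
Proof.
move=> mn kc Istable eval_e I0 Istep IQ; apply: wp_seq; apply: wp_nset => /=.
set s0 := State _ _.
have Fvar s1 s' v : frame (cfor k e c) s1 s' ->
    frame (cfor k e c) s1 (State (upd (nmem s') k 0 v) (rmem s')).
  move=> F1; apply: frame_trans F1 _; split=> //= k'.
  by rewrite inE negb_or => /andP[kk _]; rewrite upd_neq.
have F0 : frame (cfor k e c) s s0 by exact/Fvar/frame_refl.
have Fc s1 s2 : frame c s1 s2 -> frame (cfor k e c) s1 s2.
  apply: frame_sub => x; rewrite /= ?cats0 ?inE ?mem_cat => -> //.
  by rewrite orbT.
have {F0} : frame (cfor k e c) s s0 /\ nmem s0 k 0 = 0%N /\ I 0%N s0.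
  by split=> //; split; [rewrite /= /upd !eqxx | exact: Istable].
move: s0 {I0} => s0.
(* Induction on the number [r] of rounds left, with the cost bound for [r] rounds instead of [n]. *)
suff H r j s1 : (r = m - j)%N -> (j <= m)%N ->
    frame (cfor k e c) s s1 /\ nmem s1 k 0 = j /\ I j s1 ->
    exists l s', [/\ exec dist (CWhile (NLe (NAdd (nvar k) (NLit 1)) e)
        (CSeq c (CNSet k (NLit 0) (NAdd (nvar k) (NLit 1))))) s1 l s',
      (l <= bcost (NLe (NAdd (nvar k) (NLit 1)) e) +
       r * (bcost (NLe (NAdd (nvar k) (NLit 1)) e) +
         cmd_cost n (CSeq c (CNSet k (NLit 0) (NAdd (nvar k) (NLit 1))))))%N
      & Q s'].
  move=> /(H m 0%N s0 (esym (subn0 m)) (leq0n m)) [l [s' [E L q]]].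
  exists l, s'; split=> //; apply: leq_trans L _.
  by rewrite leq_add2l leq_mul2r mn orbT.
elim: r j s1 => [|r IH] j s1 rE jm [F1 [kj Ij]].
  have jE : j = m by lia.
  exists (bcost (NLe (NAdd (nvar k) (NLit 1)) e) : nat), s1; split.
  - by apply: exec_while_done; rewrite /= (eval_e _ F1) kj jE addn1 ltnn.
  - lia.
  - by apply: IQ; rewrite -?jE.
have jm' : (j < m)%N by lia.
have [k1 [s2 [E2 K2 I2]]] := Istep j s1 jm' F1 kj Ij.
pose s3 := State (upd (nmem s2) k 0 j.+1) (rmem s2).
have kj2 : nmem s2 k 0%N = j by have [-> //] := exec_frame E2.
(* The increment takes 1 step for the address, 4 for the sum and 1 for the assignment itself. *)
have E3 : exec dist (CNSet k (NLit 0) (NAdd (nvar k) (NLit 1))) s2 6 s3.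
  have := exec_nset dist k (NLit 0) (NAdd (nvar k) (NLit 1)) s2.
  by rewrite /= kj2 [(j + 1)%N]addn1.
have [|||l [s' [E' L q]]] := IH j.+1 s3; [lia|by []| |].
- split; first exact/Fvar/(frame_trans F1)/Fc/(exec_frame E2).
  by split; [rewrite /= /upd !eqxx|exact: Istable].
- exists (bcost (NLe (NAdd (nvar k) (NLit 1)) e) + (k1 + 6) + l)%N, s'; split=> //.
    apply: exec_while_step E'; last exact: exec_seq E2 E3.
    by rewrite /= (eval_e _ F1) kj addn1.
  move: L K2; rewrite mulSn /=; lia.
Qed.

End ProgramLogic.

(** * Single linkage by Prim's algorithm *)

Section SingleLinkage.
Variables (R : realType) (n : nat) (blk : nat -> nat) (D : nat -> nat -> R).
Hypothesis D_ge0 : forall x y, 0 <= D x y.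
Hypothesis D_sym : forall x y, D x y = D y x.
Hypothesis D_diag : forall x, D x x = 0.

(** [mu] is an arbitrary competitor within [chi] of [D]; it enters the invariant through
    [lk_opt]. *)
Variables (mu : nat -> nat -> R) (chi : R).
Hypothesis mu_sym : forall x y, (x < n)%N -> (y < n)%N -> blk x = blk y ->
  mu x y = mu y x.
Hypothesis mu_diag : forall x, (x < n)%N -> mu x x = 0.
Hypothesis mu_ultra : forall x y z, (x < n)%N -> (y < n)%N -> (z < n)%N ->
  blk x = blk y -> blk x = blk z -> mu x y <= Num.max (mu x z) (mu z y).
Hypothesis mu_close : forall x y, (x < n)%N -> (y < n)%N -> blk x = blk y ->
  `|D x y - mu x y| <= chi.

(* [vs] are the points already in the tree of their block; on them, [a] is the
   [M]-distance to the last point that joined the block. On the other points,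
   [a] is Prim's key, provided that the flag [has] of the block is set. *)
Record linkage (vs : seq nat) (has : nat -> bool) (M : nat -> nat -> R)
    (a : nat -> R) : Prop := Linkage {
  lk_lt : forall x, x \in vs -> (x < n)%N;
  lk_diag : forall x, (x < n)%N -> M x x = 0;
  lk_ge0 : forall x y, x \in vs -> y \in vs -> blk x = blk y -> 0 <= M x y;
  lk_sym : forall x y, x \in vs -> y \in vs -> blk x = blk y -> M x y = M y x;
  lk_ultra : forall x y z, x \in vs -> y \in vs -> z \in vs ->
    blk x = blk y -> blk x = blk z -> M x y <= Num.max (M x z) (M z y);
  lk_le : forall x y, x \in vs -> y \in vs -> blk x = blk y -> M x y <= D x y;
  lk_opt : forall x y, x \in vs -> y \in vs -> blk x = blk y ->
    mu x y <= M x y + chi;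
  lk_has : forall x, x \in vs -> has (blk x);
  lk_far_ge0 : forall x, x \in vs -> 0 <= a x;
  lk_far_sup : forall x y, x \in vs -> y \in vs -> blk x = blk y ->
    M x y <= Num.max (a x) (a y);
  lk_far_sub : forall x y, x \in vs -> y \in vs -> blk x = blk y ->
    a x <= Num.max (M x y) (a y);
  lk_far_le : forall x y, x \in vs -> (y < n)%N -> y \notin vs ->
    blk x = blk y -> a x <= D x y;
  lk_key_le : forall x y, x \in vs -> (y < n)%N -> y \notin vs ->
    blk x = blk y -> a y <= D x y;
  lk_key : forall y, (y < n)%N -> y \notin vs -> has (blk y) ->
    exists p, [/\ p \in vs, blk p = blk y & a y = D p y] }.

(** In a block already started, [v] hangs on a point [p] with [a v = D p v], and the minimax
    distance from [u] to [v] is the larger of [a u] and [a v]. Both are at most [D u v], by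
    [lk_far_le] and [lk_key_le]. By [lk_far_sup] and [lk_far_sub], [a] behaves like the distance to
    one more point of an ultrametric space, so the extended table is again ultrametric. *)
Lemma linkage_step vs has M a v has' M' a' :
  linkage vs has M a -> (v < n)%N -> v \notin vs ->
  (forall x, (x < n)%N -> x \notin vs -> a v <= a x) ->
  (forall i, has' i = (i == blk v) || has i) ->
  (forall x, (x < n)%N -> a' x =
     if blk x != blk v then a x
     else if x \in vs then Num.max (a x) (a v)
     else if has (blk v) && (a x < D v x) then a x else D v x) ->
  (forall x y, (x < n)%N -> (y < n)%N -> M' x y =
     if [&& x == v, y \in vs & blk y == blk v] then a' y
     else if [&& y == v, x \in vs & blk x == blk v] then a' x
     else M x y) ->
  linkage (v :: vs) has' M' a'.
Proof.
move=> L vn vvs minv has'E a'E M'E.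
have lt x : x \in vs -> (x < n)%N := lk_lt L (x := x).
have neqv x : x \in vs -> (x == v) = false.
  by move=> xvs; apply: contraNF vvs => /eqP <-.
have far_v u : u \in vs -> blk u = blk v ->
    [/\ a u <= D u v, a v <= D u v, 0 <= a u & 0 <= a v].
  move=> uvs uv; split; [exact: (lk_far_le L)|exact: (lk_key_le L)|
    exact: (lk_far_ge0 L)|].
  have [|p [_ _ ->]] := lk_key L vn vvs => //.
  by rewrite -uv (lk_has L uvs).
(* [v] is updated like a point outside the tree, and a key that is set is a distance, hence not
   below [D v v = 0]. So [v] ends at distance 0 from the last point, itself. *)
have a'v : a' v = 0.
  rewrite a'E// eqxx /= (negbTE vvs) D_diag; case: ifP => // /andP[hv].
  by have [p [_ _ ->]] := lk_key L vn vvs hv; rewrite ltNge D_ge0.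
have a'vs x : x \in vs -> blk x = blk v -> a' x = Num.max (a x) (a v).
  by move=> xvs xv; rewrite a'E ?lt// xv eqxx xvs.
have a'out x : x \in vs -> blk x <> blk v -> a' x = a x.
  by move=> xvs /eqP xv; rewrite a'E ?lt// xv.
have M'old x y : x \in vs -> y \in vs -> M' x y = M x y.
  by move=> xvs yvs; rewrite M'E ?lt// !neqv.
have M'v y : y \in vs -> blk y = blk v -> M' v y = Num.max (a y) (a v).
  by move=> yvs yv; rewrite M'E ?(lt _ yvs)// yvs yv !eqxx /= a'vs.
have M'v2 y : y \in vs -> blk y = blk v -> M' y v = Num.max (a y) (a v).
  by move=> yvs yv; rewrite M'E ?(lt _ yvs)// neqv// yvs yv !eqxx /= a'vs.
have M'diag x : (x < n)%N -> M' x x = 0.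
  move=> xn; rewrite M'E//; case: eqP => [->|_] /=.
    by rewrite (negbTE vvs) /= (lk_diag L).
  by rewrite (lk_diag L).
(* This and [sup_mono]: the inequalities between [a] and [M] survive replacing [a] by its maximum
   with [a v]. They serve both the new table and the new [a']. *)
have far_mono x y m : a x <= Num.max m (a y) ->
    Num.max (a x) (a v) <= Num.max m (Num.max (a y) (a v)).
  by move=> H; rewrite maxA ge_max !(le_max _ _ (a v)) H lexx orbT.
have sup_mono x y m : m <= Num.max (a x) (a y) ->
    m <= Num.max (Num.max (a x) (a v)) (Num.max (a y) (a v)).
  by move=> H; apply: le_trans H _; rewrite ge_max !le_max !lexx !orbT.
(* The competitor obeys the ultrametric inequality through [p]: [mu u p] is bounded by the invariant
   and [a p <= D p v = a v], and [mu p v] is at most [D p v + chi = a v + chi]. *)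
have opt u : u \in vs -> blk u = blk v -> mu u v <= Num.max (a u) (a v) + chi.
  move=> uvs uv.
  have [|p [pvs pv keyv]] := lk_key L vn vvs; first by rewrite -uv (lk_has L uvs).
  have up : blk u = blk p by rewrite uv.
  apply: le_trans (mu_ultra (lt _ uvs) vn (lt _ pvs) uv up) _.
  rewrite ge_max; apply/andP; split.
    apply: le_trans (lk_opt L uvs pvs up) _; rewrite lerD2r.
    apply: le_trans (lk_far_sup L uvs pvs up) _.
    by rewrite ge_max !le_max lexx keyv (lk_far_le L pvs vn vvs pv) orbT.
  apply: (@le_trans _ _ (a v + chi)); last by rewrite lerD2r le_max lexx orbT.
  have := mu_close (lt _ pvs) vn pv; rewrite -keyv ler_norml => /andP[+ _].
  by rewrite lerBrDr addrC lerBlDr.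
split.
- by move=> x; rewrite inE => /orP[/eqP ->|/lt].
- exact: M'diag.
- move=> x y; rewrite !inE => /orP[/eqP ->|xvs] /orP[/eqP ->|yvs] xy.
  + by rewrite M'diag.
  + by rewrite M'v// le_max (lk_far_ge0 L yvs).
  + by rewrite M'v2// le_max (lk_far_ge0 L xvs).
  + by rewrite M'old// (lk_ge0 L).
- move=> x y; rewrite !inE => /orP[/eqP ->|xvs] /orP[/eqP ->|yvs] xy //.
  + by rewrite M'v// M'v2.
  + by rewrite M'v// M'v2.
  + by rewrite !M'old// (lk_sym L).
(* With [v] as one endpoint the inequality comes from [lk_far_sub], with [v] as the intermediate
   point from [lk_far_sup]. *)
- move=> x y z; rewrite !inE => /orP[/eqP ->|xvs] /orP[/eqP ->|yvs]
    /orP[/eqP ->|zvs] xy xz; rewrite ?(M'diag v)// ?le_max ?lexx ?orbT//.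
  + by rewrite M'v// le_max (lk_far_ge0 L zvs).
  + rewrite -le_max !M'v// M'old// maxC; apply: far_mono.
    have zy : blk z = blk y by rewrite -xz.
    by rewrite (lk_sym L zvs yvs zy) (lk_far_sub L).
  + by rewrite -le_max !M'v2 ?M'old -?xz//; apply: far_mono; exact: (lk_far_sub L).
  + by rewrite -le_max M'v2// M'v -?xy// M'old//; apply/sup_mono/(lk_far_sup L).
  + by rewrite -le_max !M'old// (lk_ultra L).
- move=> x y; rewrite !inE => /orP[/eqP ->|xvs] /orP[/eqP ->|yvs] xy.
  + by rewrite M'diag.
  + rewrite M'v// D_sym ge_max.
    by have [-> -> _ _] := far_v _ yvs (esym xy).
  + by rewrite M'v2// ge_max; have [-> -> _ _] := far_v _ xvs xy.
  + by rewrite M'old// (lk_le L).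
- move=> x y; rewrite !inE => /orP[/eqP ->|xvs] /orP[/eqP ->|yvs] xy.
  + rewrite M'diag// mu_diag// add0r.
    exact: le_trans (normr_ge0 _) (mu_close vn vn erefl).
  + by rewrite M'v// (mu_sym vn (lt _ yvs) xy) opt.
  + by rewrite M'v2// opt.
  + by rewrite M'old// (lk_opt L).
- move=> x; rewrite has'E inE => /orP[/eqP ->|xvs]; rewrite ?eqxx//.
  by rewrite (lk_has L xvs) orbT.
- move=> x; rewrite inE => /orP[/eqP ->|xvs]; first by rewrite a'v.
  have [xv|/eqP xv] := eqVneq (blk x) (blk v).
    by rewrite a'vs// le_max (lk_far_ge0 L xvs).
  by rewrite a'out// (lk_far_ge0 L xvs).
- move=> x y; rewrite !inE => /orP[/eqP ->|xvs] /orP[/eqP ->|yvs] xy.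
  + by rewrite M'diag// a'v le_max lexx.
  + by rewrite M'v// a'v a'vs// le_max lexx orbT.
  + by rewrite M'v2// a'v a'vs// le_max lexx.
  + have := lk_far_sup L xvs yvs xy; rewrite M'old//.
    have [xv|/eqP xv] := eqVneq (blk x) (blk v).
      by rewrite !a'vs -?xy//; exact: sup_mono.
    by rewrite !a'out -?xy.
- move=> x y; rewrite !inE => /orP[/eqP ->|xvs] /orP[/eqP ->|yvs] xy.
  + by rewrite M'diag// a'v le_max lexx.
  + by rewrite M'v// a'v !le_max (lk_far_ge0 L yvs).
  + by rewrite M'v2// a'v a'vs// le_max lexx.
  + have := lk_far_sub L xvs yvs xy; rewrite M'old//.
    have [xv|/eqP xv] := eqVneq (blk x) (blk v).
      by rewrite !a'vs -?xy//; exact: far_mono.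
    by rewrite !a'out -?xy.
- move=> x y; rewrite !inE => /orP[/eqP ->|xvs] yn /norP[yv yvs] xy.
    by rewrite a'v.
  have [xv|/eqP xv] := eqVneq (blk x) (blk v); last first.
    by rewrite a'out//; exact: (lk_far_le L).
  (* The minimality of [v] enters here: for [y] left outside, [a v <= a y <= D x y]. *)
  rewrite a'vs// ge_max (lk_far_le L xvs yn yvs xy).
  exact: le_trans (minv _ yn yvs) (lk_key_le L xvs yn yvs xy).
- move=> x y; rewrite !inE => /orP[/eqP ->|xvs] yn /norP[yv yvs] xy.
    rewrite a'E// -xy eqxx (negbTE yvs) /=.
    by case: ifP => // /andP[_ /ltW].
  have key_le := lk_key_le L xvs yn yvs xy.
  rewrite a'E// (negbTE yvs); case: ifPn => // /negPn/eqP yv'.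
  rewrite -yv' -xy (lk_has L xvs) /=; case: ltP => // le_key.
  exact: le_trans le_key key_le.
- move=> y yn; rewrite !inE => /norP[yv yvs]; rewrite has'E a'E// (negbTE yvs).
  case: ifPn => [yblk|/negPn/eqP yblk _].
    rewrite (negbTE yblk) /= => /(lk_key L yn yvs)[p [pvs py ->]].
    by exists p; rewrite inE pvs orbT.
  case: ifP => [/andP[hv _]|_]; last by exists v; rewrite inE eqxx.
  have [|p [pvs py ->]] := lk_key L yn yvs; first by rewrite yblk.
  by exists p; rewrite inE pvs orbT.
Qed.

End SingleLinkage.

(** * The algorithm *)

(* Bank numbers, of the natural-number banks and then of the real banks. *)
Local Notation blk_ := 2%N.
Local Notation row_ := 3%N.
Local Notation done_ := 4%N.
Local Notation has_ := 5%N.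
Local Notation n_ := 6%N.
Local Notation x_ := 7%N.
Local Notation y_ := 8%N.
Local Notation best_ := 9%N.
Local Notation i_ := 10%N.

Local Notation key_ := 1%N.
Local Notation w_ := 2%N.
Local Notation gap_ := 3%N.

Definition rvar (k : nat) : rexp := RGet k (NLit 0).
Definition cell_addr (e1 e2 : nexp) : nexp := NAdd (NGet row_ e1) e2.
Definition NEq (e1 e2 : nexp) : bexp := BAnd (NLe e1 e2) (NLe e2 e1).
Definition RLt (e1 e2 : rexp) : bexp := BNot (RLe e2 e1).
Definition blk_at (e : nexp) : nexp := NGet blk_ e.

(** [n_] serves as the number of the next point and ends up as the total. The size of block [i] is
    in cell [i + 1], as cell 0 holds the number of blocks. *)
Definition label_points : cmd :=
  cfor i_ (NGet 0 (NLit 0))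
    (cfor y_ (NGet 0 (NAdd (nvar i_) (NLit 1)))
      (CSeq (CNSet blk_ (nvar n_) (nvar i_))
            (CNSet n_ (NLit 0) (NAdd (nvar n_) (NLit 1))))).

(** Naturals cannot be multiplied, so the row offsets [x * n] are tabulated by repeated addition,
    starting from the initial 0. *)
Definition fill_rows : cmd :=
  cfor x_ (nvar n_)
    (CNSet row_ (NAdd (nvar x_) (NLit 1)) (NAdd (NGet row_ (nvar x_)) (nvar n_))).

(* [best_] keeps its initial value n when no index satisfies [cond]. *)
Definition find_min (cond : bexp) (wt : nexp -> rexp) : cmd :=
  CSeq (CNSet best_ (NLit 0) (nvar n_))
    (cfor y_ (nvar n_)
      (CIf (BAnd cond (BNot (BAnd (NLe (NAdd (nvar best_) (NLit 1)) (nvar n_))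
                                  (RLe (wt (nvar best_)) (wt (nvar y_))))))
           (CNSet best_ (NLit 0) (nvar y_)) CSkip)).

(** [cond] selects the candidates [y_] for the point [x_]. The final test skips points without a
    candidate, which occur in the first or the last block. *)
Definition match_nearest (cond : bexp) (addr : nexp) : cmd :=
  cfor x_ (nvar n_)
    (CSeq (find_min cond (RDist (nvar x_)))
      (CIf (NLe (NAdd (nvar best_) (NLit 1)) (nvar n_))
           (CNSet 1 addr (NLit 1)) CSkip)).

(** The second pass looks backwards, with [x_] in the later block; its address is transposed so that
    the row always belongs to the earlier point. *)
Definition match_blocks : cmd :=
  CSeq (match_nearest (NEq (blk_at (nvar y_)) (NAdd (blk_at (nvar x_)) (NLit 1)))
                      (cell_addr (nvar x_) (nvar best_)))
       (match_nearest (NEq (blk_at (nvar x_)) (NAdd (blk_at (nvar y_)) (NLit 1)))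
                      (cell_addr (nvar best_) (nvar x_))).

(* The new point [best_] is not yet marked done, so it falls in the last branch:
   its entry becomes D(best, best) = 0, its distance to the last point. *)
Definition attach_best : cmd :=
  cfor y_ (nvar n_)
    (CIf (NEq (blk_at (nvar y_)) (blk_at (nvar best_)))
      (CIf (NLe (NLit 1) (NGet done_ (nvar y_)))
        (CSeq (CIf (RLe (RGet key_ (nvar y_)) (rvar w_))
                   (CRSet key_ (nvar y_) (rvar w_)) CSkip)
        (CSeq (CRSet 0 (cell_addr (nvar best_) (nvar y_)) (RGet key_ (nvar y_)))
              (CRSet 0 (cell_addr (nvar y_) (nvar best_)) (RGet key_ (nvar y_)))))
        (CIf (BAnd (NLe (NLit 1) (NGet has_ (blk_at (nvar best_))))
                   (RLt (RGet key_ (nvar y_)) (RDist (nvar best_) (nvar y_))))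
             CSkip
             (CRSet key_ (nvar y_) (RDist (nvar best_) (nvar y_)))))
      CSkip).

(** The weight is saved in [w_] since [attach_best] overwrites the key of [best_]; [done_] and
    [has_] are set afterwards since it reads their old values. Points of an untouched block have key
    0, and this weight affects no tree. *)
Definition link_points : cmd :=
  cfor x_ (nvar n_)
    (CSeq (find_min (NLe (NGet done_ (nvar y_)) (NLit 0)) (RGet key_))
    (CSeq (CRSet w_ (NLit 0) (RGet key_ (nvar best_)))
    (CSeq attach_best
    (CSeq (CNSet done_ (nvar best_) (NLit 1))
          (CNSet has_ (blk_at (nvar best_)) (NLit 1)))))).

Definition max_gap : cmd :=
  let gap := RSub (RDist (nvar x_) (nvar y_)) (RGet 0 (cell_addr (nvar x_) (nvar y_))) in
  cfor x_ (nvar n_) (cfor y_ (nvar n_)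
    (CIf (BAnd (NEq (blk_at (nvar x_)) (blk_at (nvar y_))) (RLt (rvar gap_) gap))
         (CRSet gap_ (NLit 0) gap) CSkip)).

Definition add_half_gap : cmd :=
  let c := cell_addr (nvar x_) (nvar y_) in
  cfor x_ (nvar n_) (cfor y_ (nvar n_)
    (CIf (NEq (nvar x_) (nvar y_)) CSkip
         (CRSet 0 c (RAdd (RGet 0 c) (RDiv (rvar gap_) (RLit 2)))))).

Definition clustering_cmd : cmd :=
  CSeq label_points (CSeq fill_rows (CSeq match_blocks
    (CSeq link_points (CSeq max_gap add_half_gap)))).

(** * Correctness of the passes of the program *)

Section Correctness.
Variables (R : realType) (n : nat) (blk : nat -> nat) (D : nat -> nat -> R).
Implicit Types s : state R.

(** What the two preparatory passes establish; it persists since the later passes write none of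
    these banks. *)
Definition indexed s : Prop :=
  [/\ nmem s n_ 0%N = n, forall x, (x < n)%N -> nmem s blk_ x = blk x &
      forall x, (x < n)%N -> nmem s row_ x = (x * n)%N].

Lemma indexed_frame c s s' : frame c s s' ->
  all (fun k => k \notin nbanks c) [:: blk_; row_; n_] -> indexed s -> indexed s'.
Proof.
by move=> [F _] /and4P[fb fr fn _] [? ? ?]; split; rewrite F.
Qed.

Lemma cell_inj x y x' y' : (y < n)%N -> (y' < n)%N ->
  (x * n + y == x' * n + y')%N = (x == x') && (y == y').
Proof.
move=> yn yn'; apply/eqP/andP => [E|[/eqP -> /eqP ->] //].
have [n0 {}E] : (0 < n)%N /\ (x = x' /\ y = y').
  split; first lia.
  have /(congr1 (fun z => (z %/ n)%N)) := E.
  rewrite !divnMDl ?(divn_small yn) ?(divn_small yn'); try lia.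
by split; apply/eqP; lia.
Qed.

(** The loop over the blocks must stay within the [n] rounds allowed to every loop, hence
    [size sh <= n]; nonempty blocks provide it. *)
Lemma label_points_wp sh s : n = sumn sh -> (size sh <= n)%N ->
  nmem s 0 =1 nth 0%N (size sh :: sh) -> nmem s n_ 0%N = 0%N ->
  wp D n label_points s (fun s' => nmem s' n_ 0%N = n /\
    forall x, (x < n)%N -> nmem s' blk_ x = reshape_index sh x).
Proof.
move=> nE shn input n0.
(* [flatten_index sh i c] is the sum of the first [i] sizes plus [c], which is the number of points
   labelled so far. *)
pose I i c s := nmem s n_ 0%N = flatten_index sh i c /\
  forall x, (x < flatten_index sh i c)%N -> nmem s blk_ x = reshape_index sh x.
apply: (@wp_for _ _ _ _ _ _ (fun i => I i 0%N) (size sh)) => //.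
- by move=> s' [F _]; rewrite /= F// input.
- by split; rewrite /flatten_index take0.
- move=> i s1 ilt F1 iE I1.
  have size_blk s' : frame (cfor y_ (NGet 0 (NAdd (nvar i_) (NLit 1)))
      (CSeq (CNSet blk_ (nvar n_) (nvar i_))
            (CNSet n_ (NLit 0) (NAdd (nvar n_) (NLit 1))))) s1 s' ->
      neval s' (NGet 0 (NAdd (nvar i_) (NLit 1))) = nth 0%N sh i.
    by move=> [F _]; rewrite /= !F// F1.1// iE input addn1.
  apply: (@wp_for _ _ _ _ _ _ (I i) (nth 0%N sh i)) => //.
  + rewrite nE; elim: sh i {I I1 nE shn input iE F1 size_blk} ilt => //= m sh IH [|i] ilt.
      exact: leq_addr.
    by apply: leq_trans (IH i ilt) (leq_addl _ _).
  + move=> c s2 clt F2 cE [I2n I2b]; apply: wp_seq; apply: wp_nset; apply: wp_nset.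
    have iE2 : nmem s2 i_ 0%N = i by rewrite F2.1.
    split; first by rewrite /= /upd /= I2n /flatten_index addn1 addnS.
    move=> x; rewrite /= /upd /= I2n iE2 /flatten_index addnS ltnS leq_eqVlt.
    move=> /predU1P[->|xlt]; first by rewrite eqxx -/(flatten_index _ _ _) flatten_indexKl.
    by rewrite (ltn_eqF xlt) I2b.
  + move=> s2 F2; by rewrite /I /flatten_index (take_nth 0%N ilt) sumn_rcons addn0.
- move=> s' _; rewrite /I /flatten_index take_size addn0 -nE => -[? H]; split=> //.
Qed.

Lemma fill_rows_wp s : nmem s n_ 0%N = n -> (forall x, nmem s row_ x = 0%N) ->
  wp D n fill_rows s (fun s' => forall x, (x < n)%N -> nmem s' row_ x = (x * n)%N).
Proof.
move=> sn row0.
apply: (@wp_for _ _ _ _ _ _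
  (fun j s => forall x, (x <= j)%N -> nmem s row_ x = (x * n)%N) n) => //.
- by move=> s' [F _]; rewrite /= F.
- by move=> x; rewrite leqn0 => /eqP ->.
- move=> j s1 jn [F _] jE I1; apply: wp_nset => x; rewrite /= /upd /= jE addn1.
  by rewrite leq_eqVlt => /predU1P[->|xj]; rewrite ?eqxx ?(ltn_eqF xj) ?I1// F// sn mulSn addnC.
- by move=> s' _ H x /ltnW /H.
Qed.

(** The weight hypothesis puts no bound on the index, since [wt] is also evaluated at the initial
    value [n] of [best_]. *)
Lemma find_min_wp cond wt (C : nat -> bool) (W : nat -> R) s Q :
  nmem s n_ 0%N = n ->
  (forall s', frame (find_min cond wt) s s' -> (nmem s' y_ 0 < n)%N ->
     beval D s' cond = C (nmem s' y_ 0)) ->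
  (forall s', frame (find_min cond wt) s s' ->
     reval D s' (wt (nvar best_)) = W (nmem s' best_ 0) /\
     reval D s' (wt (nvar y_)) = W (nmem s' y_ 0)) ->
  (forall s', frame (find_min cond wt) s s' ->
     let v := nmem s' best_ 0 in
     (v = n /\ forall x, (x < n)%N -> ~~ C x) \/
     [/\ (v < n)%N, C v & forall x, (x < n)%N -> C x -> W v <= W x] -> Q s') ->
  wp D n (find_min cond wt) s Q.
Proof.
move=> sn condE wtE HQ; apply: wp_seq; apply: wp_nset => /=.
set s0 := State _ _.
have F0 : frame (find_min cond wt) s s0.
  by split=> k //=; rewrite !inE => /norP[kk _]; rewrite upd_neq.
have Fs s' c : {subset nbanks c <= [:: best_; y_]} -> rbanks c = [::] ->
    frame c s0 s' -> frame (find_min cond wt) s s'.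
  move=> cn cr F; apply: frame_trans F0 _; apply: frame_sub F => [x /cn|x].
    by rewrite !inE => /orP[] /eqP ->.
  by rewrite cr.
pose I j s' := let v := nmem s' best_ 0 in
     (v = n /\ forall x, (x < j)%N -> ~~ C x) \/
     [/\ (v < n)%N, C v & forall x, (x < j)%N -> C x -> W v <= W x].
apply: (@wp_for _ _ _ _ _ _ I n) => //.
- by move=> s' [F _]; rewrite /= F//= /upd.
- by left; rewrite /s0 /= /upd.
- move=> j s1 jn F1 jE I1.
  have {}F1 : frame (find_min cond wt) s s1.
    by apply: Fs F1 => // x; rewrite /= !inE => /or3P[]->; rewrite ?orbT.
  have n1 : nmem s1 n_ 0%N = n by rewrite F1.1.
  have [wtb wty] := wtE _ F1; have c1 := condE _ F1; rewrite jE in c1 wty.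
  apply: wp_if => /=; rewrite wtb wty c1// n1 addn1.
  + move=> /andP[Cj minj]; apply: wp_nset; right; rewrite /= /upd /= jE; split=> //.
    move=> x; rewrite ltnS leq_eqVlt => /predU1P[->//|xj] Cx.
    case: I1 => [[_ /(_ _ xj)]|[vn Cv /(_ _ xj Cx)]]; first by rewrite Cx.
    move: minj; rewrite vn /= -ltNge => /ltW; exact: le_trans.
  + move=> H; apply: wp_skip; case: I1 => [[vn allC]|[vn Cv minv]].
      left; split=> // x; rewrite ltnS leq_eqVlt => /predU1P[->|/allC//].
      by move: H; rewrite vn ltnn /= andbT.
    right; split=> // x; rewrite ltnS leq_eqVlt => /predU1P[->|xj Cx]; last exact: minv.
    by move: H; rewrite vn /= => /[swap] ->; rewrite negbK.
- move=> s1 F1; apply: HQ.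
  by apply: Fs F1 => // x; rewrite /= !inE => /or3P[]->; rewrite ?orbT.
Qed.

(** The program does not know [delta]: a nearest candidate is at most as far as the one that [near]
    supplies. Flags are compared with the earlier ones so that two passes can be chained. *)
Lemma match_nearest_wp cond addr (C : nat -> nat -> bool) (f : nat -> nat -> nat)
    (delta : R) s :
  indexed s ->
  (forall s', indexed s' -> (nmem s' x_ 0 < n)%N -> (nmem s' y_ 0 < n)%N ->
     beval D s' cond = C (nmem s' x_ 0) (nmem s' y_ 0)) ->
  (forall s', indexed s' -> (nmem s' x_ 0 < n)%N -> (nmem s' best_ 0 < n)%N ->
     neval s' addr = f (nmem s' x_ 0) (nmem s' best_ 0)) ->
  (forall x y, (x < n)%N -> (y < n)%N -> C x y ->
     exists y', [/\ (y' < n)%N, C x y' & D x y' <= delta]) ->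
  wp D n (match_nearest cond addr) s (fun s' => [/\
    forall a, nmem s 1 a != 0%N -> nmem s' 1 a != 0%N,
    forall a, nmem s' 1 a != 0%N -> nmem s 1 a != 0%N \/
      exists x y, [/\ (x < n)%N, (y < n)%N, C x y, D x y <= delta & a = f x y] &
    forall x y, (x < n)%N -> (y < n)%N -> C x y ->
      exists y', [/\ (y' < n)%N, C x y' & nmem s' 1 (f x y') != 0%N]]).
Proof.
move=> ix condE addrE near.
apply: (@wp_for _ _ _ _ _ _ (fun j s' => [/\
    forall a, nmem s 1 a != 0%N -> nmem s' 1 a != 0%N,
    forall a, nmem s' 1 a != 0%N -> nmem s 1 a != 0%N \/
      exists x y, [/\ (x < n)%N, (y < n)%N, C x y, D x y <= delta & a = f x y] &
    forall x y, (x < j)%N -> (y < n)%N -> C x y ->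
      exists y', [/\ (y' < n)%N, C x y' & nmem s' 1 (f x y') != 0%N]]) n) => //.
- by move=> s' F; case: (indexed_frame F isT ix).
- by split=> // a; left.
- move=> j s1 jn F1 jE [I1 I2 I3].
  have ix1 := indexed_frame F1 isT ix.
  apply: wp_seq; apply: (@find_min_wp _ _ (C j) (D j)).
  + by case: ix1.
  + move=> s2 F2 yn; have ix2 := indexed_frame F2 isT ix1.
    by rewrite condE// F2.1// jE.
  + by move=> s2 F2; rewrite /= F2.1// jE.
  move=> s2 F2 /= best; have ix2 := indexed_frame F2 isT ix1.
  have n2 : nmem s2 n_ 0%N = n by case: ix2.
  have x2 : nmem s2 x_ 0%N = j by rewrite F2.1.
  apply: wp_if => /=; rewrite n2 addn1 => vn.
  + apply: wp_nset; rewrite /= addrE ?x2//.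
    case: best => [[vE _]|[_ Cv minv]]; first by rewrite vE ltnn in vn.
    split=> [a Ha|a|x y] /=; rewrite /upd /= (F2.1 1%N)//.
    * by case: ifP => // _; exact: I1.
    * have [-> _|_ /I2 //] := eqVneq a (f j (nmem s2 best_ 0%N)); right.
      have [y [yn Cy dy]] := near _ _ jn vn Cv.
      by exists j, (nmem s2 best_ 0%N); split=> //; exact: le_trans (minv _ yn Cy) dy.
    * rewrite ltnS leq_eqVlt => /predU1P[->|xj] yn Cxy.
        by exists (nmem s2 best_ 0%N); rewrite eqxx.
      have [y' [y'n Cxy' fl]] := I3 _ _ xj yn Cxy.
      by exists y'; split=> //; case: ifP.
  + apply: wp_skip; rewrite F2.1//; split=> // x y.
    rewrite ltnS leq_eqVlt => /predU1P[->|xj] yn Cxy; last exact: I3 Cxy.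
    case: best => [[_ /(_ _ yn)]|[vn' _ _]]; first by rewrite Cxy.
    by rewrite vn' in vn.
Qed.

Hypothesis D_ge0 : forall x y, 0 <= D x y.
Hypothesis D_sym : forall x y, D x y = D y x.
Hypothesis D_diag : forall x, D x x = 0.

(** Ranging over pairs in consecutive blocks restricts the claims to points that have a neighbouring
    block. The forward pass supplies [y'], the backward one [x'], and the flags of the former
    survive the latter. *)
Lemma match_blocks_wp (delta : R) s : indexed s -> (forall a, nmem s 1 a = 0%N) ->
  (forall x y, (x < n)%N -> (y < n)%N -> blk y = (blk x).+1 ->
    (exists y', [/\ (y' < n)%N, blk y' = (blk x).+1 & D x y' <= delta]) /\
    (exists x', [/\ (x' < n)%N, blk y = (blk x').+1 & D x' y <= delta])) ->
  wp D n match_blocks s (fun s' => forall x y, (x < n)%N -> (y < n)%N ->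
    blk y = (blk x).+1 ->
    [/\ nmem s' 1 (x * n + y)%N != 0%N -> D x y <= delta,
        exists y', [/\ (y' < n)%N, blk y' = (blk x).+1 &
                       nmem s' 1 (x * n + y')%N != 0%N] &
        exists x', [/\ (x' < n)%N, blk y = (blk x').+1 &
                       nmem s' 1 (x' * n + y)%N != 0%N]]).
Proof.
move=> ix flag0 near; apply: wp_seq.
pose C x y := blk y == (blk x).+1.
apply: wp_conseq (@match_nearest_wp _ _ C (fun x y => x * n + y)%N delta _ ix _ _ _) _.
- by move=> s' [_ b _] xn yn; rewrite /= !b// addn1 -eqn_leq.
- by move=> s' [_ _ r] xn yn; rewrite /= r.
- move=> x y xn yn /eqP xy; have [[y' [? /eqP ? ?]] _] := near _ _ xn yn xy.
  by exists y'.
move=> s1 F1 [_ S1 N1]; have ix1 := indexed_frame F1 isT ix.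
apply: wp_conseq (@match_nearest_wp _ _ (fun x y => C y x) (fun x y => y * n + x)%N
  delta _ ix1 _ _ _) _.
- by move=> s' [_ b _] xn yn; rewrite /= !b// addn1 -eqn_leq.
- by move=> s' [_ _ r] xn yn; rewrite /= r.
- move=> x y xn yn /eqP xy; have [_ [x' [? /eqP ? ?]]] := near _ _ yn xn xy.
  by exists x'; rewrite D_sym.
move=> s2 F2 [K2 S2 N2] x y xn yn xy; split.
- move=> /S2[/S1[|]|].
  + by rewrite flag0 eqxx.
  + by move=> [x' [y' [x'n y'n _ ? /eqP]]]; rewrite cell_inj// => /andP[/eqP -> /eqP ->].
  + move=> [y' [x' [y'n x'n _ ? /eqP]]]; rewrite cell_inj// => /andP[/eqP -> /eqP ->].
    by rewrite D_sym.
- have [|y' [? /eqP ? ?]] := N1 _ _ xn yn; first exact/eqP.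
  by exists y'; split=> //; exact: K2.
- by have [|x' [? /eqP ? ?]] := N2 _ _ yn xn; [exact/eqP|exists x'].
Qed.

(** The new keys and table are given by the formulas that [linkage_step] expects. *)
Lemma attach_best_wp (vs : seq nat) v s : indexed s -> nmem s best_ 0%N = v -> (v < n)%N ->
  v \notin vs -> (forall x, (x < n)%N -> (0 < nmem s done_ x)%N = (x \in vs)) ->
  rmem s w_ 0%N = rmem s key_ v ->
  let a' x :=
     if blk x != blk v then rmem s key_ x
     else if x \in vs then Num.max (rmem s key_ x) (rmem s key_ v)
     else if (0 < nmem s has_ (blk v))%N && (rmem s key_ x < D v x)
       then rmem s key_ x else D v x in
  wp D n attach_best s (fun s' =>
    (forall x, (x < n)%N -> rmem s' key_ x = a' x) /\
    (forall x y, (x < n)%N -> (y < n)%N -> rmem s' 0 (x * n + y)%N =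
       if [&& x == v, y \in vs & blk y == blk v] then a' y
       else if [&& y == v, x \in vs & blk x == blk v] then a' x
       else rmem s 0 (x * n + y)%N)).
Proof.
move=> ix vE vn vvs vsE wE a'.
(* After [j] rounds, the keys below [j] are new, and so are the cells joining [v] to tree points
   below [j]. The weight is read from [w_], since the round of [v] itself changes its key. *)
apply: (@wp_for _ _ _ _ _ _ (fun j s' =>
    (forall x, (x < n)%N -> rmem s' key_ x = if (x < j)%N then a' x else rmem s key_ x) /\
    (forall x y, (x < n)%N -> (y < n)%N -> rmem s' 0 (x * n + y)%N =
       if [&& x == v, (y < j)%N, y \in vs & blk y == blk v] then a' y
       else if [&& y == v, (x < j)%N, x \in vs & blk x == blk v] then a' x
       else rmem s 0 (x * n + y)%N)) n) => //.
- by move=> s' F; case: (indexed_frame F isT ix).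
- by split=> // x y; rewrite !andbF.
- move=> j s1 jn F1 jE [I1 I2]; have ix1 := indexed_frame F1 isT ix.
  have [_ b1 r1] := ix1.
  have v1 : nmem s1 best_ 0%N = v by rewrite F1.1.
  have w1 : rmem s1 w_ 0%N = rmem s key_ v by rewrite F1.2.
  have keyj : rmem s1 key_ j = rmem s key_ j by rewrite I1// ltnn.
  have skip_key (m : nat -> R) :
      (forall x, (x < n)%N -> m x = if x == j then a' j else rmem s1 key_ x) ->
      forall x, (x < n)%N -> m x = if (x < j.+1)%N then a' x else rmem s key_ x.
    move=> mE x xn; rewrite mE// ltnS leq_eqVlt.
    by case: eqVneq => [->//|_] /=; exact: I1.
  have skip_M : ~~ ((j \in vs) && (blk j == blk v)) ->
      forall x y, (x < n)%N -> (y < n)%N -> rmem s1 0 (x * n + y)%N =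
       if [&& x == v, (y < j.+1)%N, y \in vs & blk y == blk v] then a' y
       else if [&& y == v, (x < j.+1)%N, x \in vs & blk x == blk v] then a' x
       else rmem s 0 (x * n + y)%N.
    move=> nj x y xn yn.
    have ltj z : [&& (z < j.+1)%N, z \in vs & blk z == blk v] =
                 [&& (z < j)%N, z \in vs & blk z == blk v].
      rewrite ltnS leq_eqVlt; case: eqVneq => [->|//].
      by rewrite (negbTE nj) !andbF.
    by rewrite I2// !ltj.
  apply: wp_if => /=; rewrite jE v1 !b1// -eqn_leq => jv; last first.
    apply: wp_skip; split; last by apply: skip_M; rewrite (negbTE jv) andbF.
    by apply: skip_key => x _; case: eqP => // ->; rewrite /a' jv keyj.
  apply: wp_if => /=; rewrite jE F1.1// vsE// => jvs.
    apply: wp_seq.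
    have jNv : j != v by apply: contraNneq vvs => <-.
    apply: (@wp_conseq _ _ _ _ _ (fun s2 => nmem s2 = nmem s1 /\
      rmem s2 0 = rmem s1 0 /\ forall x, (x < n)%N ->
        rmem s2 key_ x = if x == j then a' j else rmem s1 key_ x)).
      have a'j : a' j = Num.max (rmem s key_ j) (rmem s key_ v) by rewrite /a' jv jvs.
      apply: wp_if => /=; rewrite jE keyj w1 => cmp.
        apply: wp_rset => /=; rewrite jE w1; split=> //; split=> // x xn.
        by rewrite /upd /= a'j max_r.
      apply: wp_skip; split=> //; split=> // x xn.
      by case: eqP => [->|//]; rewrite keyj a'j max_l// ltW// ltNge.
    move=> s2 _ [nE [M2 K2]]; apply: wp_seq; apply: wp_rset; apply: wp_rset => /=.
    rewrite !nE jE v1 !r1//; split; first exact: skip_key.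
    have ltjE z : (z < j.+1)%N = (z == j) || (z < j)%N by rewrite ltnS leq_eqVlt.
    move=> x y xn yn; rewrite /upd /= !cell_inj// M2 K2// eqxx I2// !ltjE.
    have [->|xv] := eqVneq x v; have [->|yv] := eqVneq y v;
      rewrite /= ?(negbTE vvs) ?andbF ?(eq_sym v j) ?(negbTE jNv) ?andbF //=.
    - by have [->|] := eqVneq y j; rewrite ?jvs ?jv.
    - by have [->|] := eqVneq x j; rewrite ?jvs ?jv ?andbT ?andbF.
  have {}skip_M := skip_M (introN andP (fun h => negP jvs h.1)).
  have a'j : a' j = if (0 < nmem s has_ (blk v))%N && (rmem s key_ j < D v j)
       then rmem s key_ j else D v j by rewrite /a' jv (negbTE jvs).
  apply: wp_if => /=; rewrite jE v1 !b1// F1.1// keyj -ltNge => cmp.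
    apply: wp_skip; split=> //.
    by apply: skip_key => x _; case: eqP => // ->; rewrite a'j cmp.
  apply: wp_rset => /=; rewrite jE v1; split=> //.
  by apply: skip_key => x _; rewrite /upd /= a'j (negbTE cmp).
- by move=> s' _ [H1 H2]; split=> [x xn|x y xn yn]; rewrite ?H1 ?H2// ?xn ?yn.
Qed.

(** * Optimal ultrametrics, measured against a competitor *)

Variables (mu : nat -> nat -> R) (chi : R).
Hypothesis mu_sym : forall x y, (x < n)%N -> (y < n)%N -> blk x = blk y ->
  mu x y = mu y x.
Hypothesis mu_diag : forall x, (x < n)%N -> mu x x = 0.
Hypothesis mu_ultra : forall x y z, (x < n)%N -> (y < n)%N -> (z < n)%N ->
  blk x = blk y -> blk x = blk z -> mu x y <= Num.max (mu x z) (mu z y).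
Hypothesis mu_close : forall x y, (x < n)%N -> (y < n)%N -> blk x = blk y ->
  `|D x y - mu x y| <= chi.
Hypothesis chi_ge0 : 0 <= chi.

Let table s x y : R := rmem s 0 (x * n + y)%N.

Let link_state vs s : Prop :=
  [/\ uniq vs, linkage n blk D mu chi vs (fun i => 0 < nmem s has_ i)%N (table s)
         (rmem s key_) &
      forall x, (x < n)%N -> (0 < nmem s done_ x)%N = (x \in vs)].

(** One point joins per round: while fewer than [n] rounds are done some point is still outside, and
    after [n] rounds all have joined. *)
Lemma link_points_wp s : indexed s ->
  (forall a, nmem s done_ a = 0%N) -> (forall a, nmem s has_ a = 0%N) ->
  (forall a, rmem s 0 a = 0) ->
  wp D n link_points s (fun s' => exists vs, (forall x, (x < n)%N -> x \in vs) /\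
    linkage n blk D mu chi vs (fun i => 0 < nmem s' has_ i)%N (table s') (rmem s' key_)).
Proof.
move=> ix done0 has0 M0.
apply: (@wp_for _ _ _ _ _ _ (fun j s' => exists2 vs, size vs = j & link_state vs s') n) => //.
- by move=> s' F; case: (indexed_frame F isT ix).
- exists [::] => //; split=> // [|x _]; last by rewrite done0.
  by split=> // y; rewrite /table ?M0 ?has0.
- move=> j s1 jn F1 jE [vs vsj [vsU L vsE]]; have ix1 := indexed_frame F1 isT ix.
  apply: wp_seq.
  apply: (@find_min_wp _ _ (fun x => x \notin vs) (rmem s1 key_)).
  + by case: ix1.
  + by move=> s2 F2 yn; rewrite /= F2.1// -vsE// -leqNgt.
  + by move=> s2 F2; rewrite /= F2.2.
  move=> s2 F2 v min_v; have ix2 := indexed_frame F2 isT ix1.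
  have {min_v} [vn vvs min_v] : [/\ (v < n)%N, v \notin vs &
      forall x, (x < n)%N -> x \notin vs -> rmem s1 key_ v <= rmem s1 key_ x].
    case: min_v => // -[_ all_vs].
    have : {subset iota 0 n <= vs}.
      by move=> x; rewrite mem_iota => /andP[_ /all_vs]; rewrite negbK.
    by move=> /(uniq_leq_size (iota_uniq 0 n)); rewrite size_iota vsj leqNgt jn.
  apply: wp_seq; apply: wp_rset => /=; set s3 := State _ _.
  have vE : nmem s2 best_ 0%N = v by [].
  have key3 : rmem s3 key_ = rmem s1 key_ by rewrite /s3 /= upd_neq// F2.2.
  have M3 : rmem s3 0%N = rmem s1 0%N by rewrite /s3 /= upd_neq// F2.2.
  have has3 : nmem s3 has_ = nmem s1 has_ by rewrite /s3 /= F2.1.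
  have ix3 : indexed s3 by case: ix2.
  apply: wp_seq; apply: wp_conseq (@attach_best_wp vs v s3 ix3 vE vn vvs _ _) _.
  + by move=> x xn; rewrite /s3 /= F2.1// vsE.
  + by rewrite key3 /s3 /= /upd /= F2.2.
  move=> s4 F4 [key4 M4]; have ix4 := indexed_frame F4 isT ix3.
  have v4 : nmem s4 best_ 0%N = v by rewrite F4.1.
  apply: wp_seq; apply: wp_nset; apply: wp_nset.
  exists (v :: vs); first by rewrite /= vsj.
  split; first by rewrite /= vvs.
  + rewrite key3 in key4.
    apply: (@linkage_step _ _ _ _ D_ge0 D_sym D_diag _ _ mu_sym mu_diag mu_ultra
      mu_close _ _ _ _ _ _ _ _ L vn vvs min_v _ _ _).
    * move=> i; rewrite /= /upd /= v4; have [_ -> // _] := ix4; rewrite (F4.1 has_ isT) has3.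
      by case: eqVneq.
    * by move=> x xn; rewrite /= key4// has3.
    * by move=> x y xn yn; rewrite /table /= M4// !key4// key3 M3 has3.
  + move=> x xn; rewrite /= /upd /= v4 inE (F4.1 done_ isT) /s3 /= (F2.1 done_ isT).
    by case: eqVneq => //= _; exact: vsE.
- move=> s' _ [vs vsn [vsU L _]]; exists vs; split=> //.
  have sub : {subset vs <= iota 0 n}.
    by move=> x /(lk_lt L); rewrite mem_iota.
  have [|_ vsE] := uniq_min_size vsU sub; first by rewrite size_iota vsn.
  by move=> x xn; rewrite vsE mem_iota.
Qed.

Lemma max_gap_wp s : indexed s -> rmem s gap_ 0%N = 0 ->
  (forall x y, (x < n)%N -> (y < n)%N -> blk x = blk y ->
     D x y - table s x y <= chi + chi) ->
  wp D n max_gap s (fun s' => let g := rmem s' gap_ 0%N in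
    [/\ 0 <= g, g <= chi + chi &
     forall x y, (x < n)%N -> (y < n)%N -> blk x = blk y ->
       D x y - table s x y <= g]).
Proof.
move=> ix g0 gap_le.
(* Pairs are visited in lexicographic order. The initial gap 0 meets the upper bound because
   [0 <= chi]. *)
pose I j i s' := let g := rmem s' gap_ 0%N in
  [/\ 0 <= g, g <= chi + chi & forall x y, (x < n)%N -> (y < n)%N -> blk x = blk y ->
       (x < j)%N || (x == j) && (y < i)%N -> D x y - table s x y <= g].
apply: (@wp_for _ _ _ _ _ _ (fun j => I j 0%N) n) => //.
- by move=> s' F; case: (indexed_frame F isT ix).
- split; rewrite ?g0//; first exact: addr_ge0.
  by move=> x y _ _ _; rewrite ltn0 andbF.
- move=> j s1 jn F1 jE I1; have ix1 := indexed_frame F1 isT ix.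
  apply: (@wp_for _ _ _ _ _ _ (I j) n) => //.
  + by move=> s' F; case: (indexed_frame F isT ix1).
  + move=> i s2 iltn F2 iE [g1 g2 g3]; have ix2 := indexed_frame F2 isT ix1.
    have j2 : nmem s2 x_ 0%N = j by rewrite F2.1.
    have [_ b2 r2] := ix2.
    have M2 : rmem s2 0%N = rmem s 0%N by rewrite F2.2// F1.2.
    have grow g : rmem s2 gap_ 0%N <= g ->
        (blk j = blk i -> D j i - table s j i <= g) ->
        forall x y, (x < n)%N -> (y < n)%N -> blk x = blk y ->
        (x < j)%N || (x == j) && (y < i.+1)%N -> D x y - table s x y <= g.
      move=> gg gji x y xn yn xy /orP[xj|/andP[/eqP xj]].
        by apply: le_trans gg; apply: g3 => //; rewrite xj.
      rewrite ltnS leq_eqVlt => /predU1P[yi|yi].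
        by rewrite xj yi in xy *; exact: gji.
      by apply: le_trans gg; apply: g3 => //; rewrite xj eqxx yi orbT.
    apply: wp_if => /=; rewrite iE j2 !b2// r2// M2 -eqn_leq -/(table s j i).
    * move=> /andP[/eqP ji]; rewrite -ltNge => lt_gap.
      apply: wp_rset; rewrite /I /= /upd /= iE j2 r2// M2 -/(table s j i).
      split; [lra|exact: gap_le|apply: grow => //; exact: ltW].
    * move=> ng; apply: wp_skip; split=> //; apply: grow => // ji.
      by move: ng; rewrite ji eqxx /= negbK.
  + move=> s2 _ [g1 g2 g3]; split=> // x y xn yn xy.
    rewrite ltn0 andbF orbF ltnS leq_eqVlt => xj.
    by apply: g3 => //; rewrite yn andbT orbC.
- move=> s' _ [g1 g2 g3]; split=> // x y xn yn xy.
  by apply: g3 => //; rewrite xn.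
Qed.

Lemma add_half_gap_wp s : indexed s ->
  wp D n add_half_gap s (fun s' => forall x y, (x < n)%N -> (y < n)%N ->
    table s' x y = if x == y then table s x y
                   else table s x y + rmem s gap_ 0%N / 2).
Proof.
move=> ix.
pose I j i s' := forall x y, (x < n)%N -> (y < n)%N -> table s' x y =
  if ((x < j)%N || (x == j) && (y < i)%N) && (x != y)
  then table s x y + rmem s gap_ 0%N / 2 else table s x y.
apply: (@wp_for _ _ _ _ _ _ (fun j => I j 0%N) n) => //.
- by move=> s' F; case: (indexed_frame F isT ix).
- by move=> x y xn yn; rewrite ltn0 !andbF.
- move=> j s1 jn F1 jE I1; have ix1 := indexed_frame F1 isT ix.
  apply: (@wp_for _ _ _ _ _ _ (I j) n) => //.
  + by move=> s' F; case: (indexed_frame F isT ix1).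
  + move=> i s2 iltn F2 iE I2; have [_ _ r2] := indexed_frame F2 isT ix1.
    have j2 : nmem s2 x_ 0%N = j by rewrite F2.1.
    have gap2 : rmem s2 gap_ 0%N = rmem s gap_ 0%N by rewrite F2.2// F1.2.
    have ltiE y : (y < i.+1)%N = (y == i) || (y < i)%N by rewrite ltnS leq_eqVlt.
    apply: wp_if => /=; rewrite iE j2 -eqn_leq => ji.
      apply: wp_skip => x y xn yn; rewrite I2// ltiE.
      have [->|] := eqVneq x j; have [->|] := eqVneq y i; rewrite ?orbF//.
      by rewrite ji !andbF.
    apply: wp_rset => x y xn yn; rewrite /table /= /upd /= iE j2 r2// cell_inj//.
    rewrite -!/(table _ _ _) ltiE gap2 (I2 j i jn iltn) (I2 x y xn yn).
    have [->|] := eqVneq x j; have [->|] := eqVneq y i; rewrite ?orbF//=.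
    by rewrite !ltnn andbF ji orbT.
  + move=> s2 _ I2 x y xn yn; rewrite I2// yn andbT ltn0 andbF orbF.
    by rewrite ltnS (leq_eqVlt x j) orbC.
- move=> s' _ I1 x y xn yn; rewrite I1// xn /=; by case: eqVneq.
Qed.

Lemma clustering_cmd_wp sh (delta : R) s :
  n = sumn sh -> (size sh <= n)%N -> blk = reshape_index sh ->
  nmem s 0 =1 nth 0%N (size sh :: sh) -> (forall k a, k != 0%N -> nmem s k a = 0%N) ->
  (forall k a, rmem s k a = 0) ->
  (forall x y, (x < n)%N -> (y < n)%N -> blk y = (blk x).+1 ->
    (exists y', [/\ (y' < n)%N, blk y' = (blk x).+1 & D x y' <= delta]) /\
    (exists x', [/\ (x' < n)%N, blk y = (blk x').+1 & D x' y <= delta])) ->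
  wp D n clustering_cmd s (fun s' =>
    (forall x y, (x < n)%N -> (y < n)%N -> blk y = (blk x).+1 ->
      [/\ nmem s' 1 (x * n + y)%N != 0%N -> D x y <= delta,
          exists y', [/\ (y' < n)%N, blk y' = (blk x).+1 &
                         nmem s' 1 (x * n + y')%N != 0%N] &
          exists x', [/\ (x' < n)%N, blk y = (blk x').+1 &
                         nmem s' 1 (x' * n + y)%N != 0%N]]) /\
    (forall x y z, (x < n)%N -> (y < n)%N -> (z < n)%N -> blk x = blk y -> blk x = blk z ->
      [/\ 0 <= table s' x y, table s' x x = 0, table s' x y = table s' y x,
          table s' x y <= Num.max (table s' x z) (table s' z y) &
          `|D x y - table s' x y| <= chi])).
Proof.
move=> nE shn blkE input n0 r0 near.
apply: wp_seq; apply: wp_conseq (label_points_wp nE shn input (n0 n_ 0%N isT)) _.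
move=> s1 F1 [n1 blk1].
apply: wp_seq; apply: wp_conseq (fill_rows_wp n1 _) _.
  by move=> x; rewrite F1.1// n0.
move=> s2 F2 row2.
have ix2 : indexed s2.
  by split=> [|x xn|x xn]; rewrite ?row2// F2.1// blk1// blkE.
apply: wp_seq; apply: wp_conseq (match_blocks_wp ix2 _ near) _.
  by move=> a; rewrite F2.1// F1.1// n0.
move=> s3 F3 flag3; have ix3 := indexed_frame F3 isT ix2.
apply: wp_seq; apply: wp_conseq (link_points_wp ix3 _ _ _) _.
- by move=> a; rewrite F3.1// F2.1// F1.1// n0.
- by move=> a; rewrite F3.1// F2.1// F1.1// n0.
- by move=> a; rewrite F3.2// F2.2// F1.2.
move=> s4 F4 [vs [vsn L]]; have ix4 := indexed_frame F4 isT ix3.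
(* Closeness gives [D <= mu + chi], and [lk_opt] bounds [mu] by the table plus [chi]; so half of the
   largest gap never exceeds [chi]. *)
have gap4 x y : (x < n)%N -> (y < n)%N -> blk x = blk y ->
    D x y - table s4 x y <= chi + chi.
  move=> xn yn xy; have := lk_opt L (vsn _ xn) (vsn _ yn) xy.
  have := mu_close xn yn xy; rewrite ler_norml; lra.
apply: wp_seq; apply: wp_conseq (max_gap_wp ix4 _ gap4) _.
  by rewrite F4.2// F3.2// F2.2// F1.2.
move=> s5 F5 [g0 g2 gap5]; have ix5 := indexed_frame F5 isT ix4.
apply: wp_conseq (add_half_gap_wp ix5) _.
move=> s6 F6 M6; split.
  by move=> x y xn yn xy; rewrite F6.1// F5.1// F4.1//; exact: flag3.
have M5 x y : table s5 x y = table s4 x y by rewrite /table F5.2.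
move=> x y z xn yn zn xy xz; rewrite !M6// !M5 !eqxx.
have diag a : (a < n)%N -> table s4 a a = 0 := lk_diag L (x := a).
have ge0' a b : (a < n)%N -> (b < n)%N -> blk a = blk b ->
    0 <= if a == b then table s4 a b else table s4 a b + rmem s5 gap_ 0%N / 2.
  move=> an bn ab; have := lk_ge0 L (vsn _ an) (vsn _ bn) ab.
  by case: ifP => // _ ?; rewrite addr_ge0// divr_ge0.
split.
- exact: ge0'.
- exact: diag.
- by rewrite eq_sym (lk_sym L (vsn _ xn) (vsn _ yn) xy).
(* When the three points are distinct, all terms are shifted by the same amount; the other cases are
   immediate. *)
- have [xye|xye] := eqVneq x y; first by rewrite -xye diag// le_max ge0'.
  have [<-|_] := eqVneq x z; first by rewrite (negbTE xye) le_max lexx orbT.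
  have [->|_] := eqVneq z y; first by rewrite le_max lexx.
  by rewrite -addr_maxl lerD2r (lk_ultra L) ?vsn.
- have [xye|xye] := eqVneq x y; first by rewrite xye D_diag// diag// subrr normr0.
  (* [D] exceeds the unshifted table by an amount between 0 and the largest gap [g], so shifting by
     the midpoint [g / 2] leaves an error of at most [g / 2 <= chi]. *)
  have := gap5 _ _ xn yn xy; have := lk_le L (vsn _ xn) (vsn _ yn) xy.
  rewrite ler_norml; lra.
Qed.

End Correctness.

(** * From point numbers to points *)

Section Presentation.
Variables (R : realType) (X : metricType R).
Implicit Types (P : seq {fset X}) (pts : seq (seq X)).

(** [0 <= c] accounts for the default value 0 of the maxima. *)
Lemma Linfty_leP (A : {fset X}) (d1 d2 : X -> X -> R) (c : R) : 0 <= c ->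
  {in A &, forall p q, `|d1 p q - d2 p q| <= c} <-> Linfty A d1 d2 <= c.
Proof.
move=> c0; split=> [H|H p q pA qA].
  rewrite /Linfty big_seq; apply: bigmax_le => // p pA.
  by rewrite big_seq; apply: bigmax_le => // q qA; exact: H.
apply: le_trans H; rewrite /Linfty.
apply: (@bigmax_sup_seq _ _ _ _ _ p) => //.
exact: (@le_bigmax_seq _ _ _ _ _ q).
Qed.

Lemma corr_width_leP (C : {fset X * X}) (c : R) : 0 <= c ->
  {in C, forall uv, mdist uv.1 uv.2 <= c} <-> corr_width C <= c.
Proof.
move=> c0; split=> [H|H uv uvC].
  by rewrite /corr_width big_seq; apply: bigmax_le.
by apply: le_trans H; rewrite /corr_width; exact: (@le_bigmax_seq _ _ _ _ _ uv).
Qed.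

Lemma dist_oracle_ge0 pts x y : 0 <= dist_oracle pts x y.
Proof.
by rewrite /dist_oracle; case: onth => // u; case: onth => // v; exact: mdist_ge0.
Qed.

Lemma dist_oracle_sym pts x y : dist_oracle pts x y = dist_oracle pts y x.
Proof.
by rewrite /dist_oracle; case: onth => [u|]; case: onth => // v; exact: metric_sym.
Qed.

Lemma dist_oracle_diag pts x : dist_oracle pts x x = 0.
Proof. by rewrite /dist_oracle; case: onth => // u; exact: mdistxx. Qed.

Variables (P : seq {fset X}) (pts : seq (seq X)).
Hypothesis pres : presentation P pts.

Lemma size_presentation : size P = size pts.
Proof. by case: pres => _ <-; rewrite size_map. Qed.

Lemma nth_presentation i : (i < size pts)%N ->
  nth fset0 P i =i nth [::] pts i.
Proof. by case: pres => _ <- ilt x; rewrite (nth_map [::])// in_fset. Qed.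

Lemma sampling_size_presentation : sampling_size P = sumn (shape pts).
Proof.
case: pres => U <-; rewrite /sampling_size big_map /shape sumnE big_map.
apply: eq_big_seq => s spts; rewrite card_fseq undup_id//.
exact: (allP U).
Qed.

Lemma pt_numberP i x : (i < size pts)%N -> x \in nth fset0 P i ->
  [/\ (pt_number pts i x < sumn (shape pts))%N,
      reshape_index (shape pts) (pt_number pts i x) = i &
      onth (flatten pts) (pt_number pts i x) = Some x].
Proof.
move=> ilt; rewrite nth_presentation// => xi.
have clt : (index x (nth [::] pts i) < nth 0 (shape pts) i)%N.
  by rewrite (nth_map [::])// index_mem.
have nlt := flatten_indexP clt.
rewrite /pt_number flatten_indexKl//; split=> //.
rewrite onthE (nth_map x) ?size_flatten// nth_flatten flatten_indexKl//.
by rewrite flatten_indexKr// nth_index.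
Qed.

(** Each list is free of repetitions, so [index] recovers the position of an entry from the point
    stored there. *)
Lemma pt_number_surj a : (a < sumn (shape pts))%N -> exists i x,
  [/\ (i < size pts)%N, x \in nth fset0 P i & pt_number pts i x = a].
Proof.
move=> an; pose i := reshape_index (shape pts) a.
have ilt : (i < size pts)%N by have := reshape_indexP an; rewrite size_map.
have := reshape_offsetP an; rewrite -/i (nth_map [::])// => clt.
case E : (nth [::] pts i) clt => [//|x0 s] clt; rewrite -E in clt.
exists i, (nth x0 (nth [::] pts i) (reshape_offset (shape pts) a)); split=> //.
  by rewrite nth_presentation// mem_nth.
rewrite /pt_number index_uniq// ?reshape_indexK//.
by case: pres => /allP U _; apply/U/mem_nth.
Qed.

Lemma dist_oracleE i j x y : (i < size pts)%N -> (j < size pts)%N ->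
  x \in nth fset0 P i -> y \in nth fset0 P j ->
  dist_oracle pts (pt_number pts i x) (pt_number pts j y) = mdist x y.
Proof.
move=> ilt jlt /(pt_numberP ilt)[_ _ xE] /(pt_numberP jlt)[_ _ yE].
by rewrite /dist_oracle xE yE.
Qed.

Lemma size_le_sampling_size : temporal_sampling P -> (size P <= sampling_size P)%N.
Proof.
move=> [_ Pne]; rewrite /sampling_size -sum1_size big_seq [leqRHS]big_seq.
by apply: leq_sum => A /Pne; rewrite cardfs_gt0.
Qed.

End Presentation.

(** * The quadratic-time algorithm on point sets *)

Theorem theorem6 (R : realType) :
  exists (alg : cmd) (K : nat),
    forall (X : metricType R) (P : seq {fset X}) (pts : seq (seq X))
      (chi delta : R),
      temporal_sampling P ->
      presentation P pts ->
      (0 <= chi)%R -> (0 <= delta)%R ->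
      (exists (mu : nat -> X -> X -> R) (C : nat -> {fset X * X}),
          local_clustering P chi delta mu C) ->
      exists (k : nat) (s : state R),
        [/\ exec (dist_oracle pts) alg (init_state pts) k s,
            (k <= K * sampling_size P ^ 2)%N &
            local_clustering P chi delta (out_metric pts s) (out_corr pts P s)].
Proof.
(* [K] is the cost for one round per loop; loops are nested at most two deep, which gives the
   exponent 2. *)
exists clustering_cmd, (cmd_cost 1 clustering_cmd).
move=> X P pts chi delta samp pres chi0 delta0 [mu [C [muP CP]]].
have nE := sampling_size_presentation pres; have sP := size_presentation pres.
set n := sampling_size P in nE *.
have tn : (size (shape pts) <= n)%N.
  by rewrite size_map -sP size_le_sampling_size.
have n0 : (0 < n)%N.
  by apply: leq_trans tn; rewrite size_map -sP; case: samp.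
pose blk := reshape_index (shape pts).
pose D := dist_oracle pts.
have surj a : (a < n)%N -> exists x, [/\ (blk a < size pts)%N,
    x \in nth fset0 P (blk a), pt_number pts (blk a) x = a &
    onth (flatten pts) a = Some x].
  rewrite nE => /(pt_number_surj pres)[i [x [ilt xi <-]]]; exists x.
  by have [_ bE ->] := pt_numberP pres ilt xi; rewrite /blk bE.
(* The given ultrametrics, carried over to point numbers; a pair is measured in the block of its
   first number. *)
pose nu a b := if onth (flatten pts) a is Some x then
  if onth (flatten pts) b is Some y then mu (blk a) x y else 0 else 0.
have nu_sym x y : (x < n)%N -> (y < n)%N -> blk x = blk y -> nu x y = nu y x.
  move=> /surj[u [ilt ux _ uE]] /surj[v [_ vy _ vE]] xy.
  have [[[_ _ sym _] _] _] := muP _ (eq_ind_r (fun t => blk x < t)%N ilt sP).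
  by rewrite /nu uE vE -xy; apply: sym; rewrite // xy.
have nu_diag x : (x < n)%N -> nu x x = 0.
  move=> /surj[u [ilt ux _ uE]].
  have [[[_ diag _ _] _] _] := muP _ (eq_ind_r (fun t => blk x < t)%N ilt sP).
  by rewrite /nu uE; exact: diag.
have nu_ultra x y z : (x < n)%N -> (y < n)%N -> (z < n)%N ->
    blk x = blk y -> blk x = blk z -> nu x y <= Num.max (nu x z) (nu z y).
  move=> /surj[u [ilt ux _ uE]] /surj[v [_ vy _ vE]] /surj[w [_ wz _ wE]] xy xz.
  have [[_ ultra] _] := muP _ (eq_ind_r (fun t => blk x < t)%N ilt sP).
  rewrite -xy in vy; rewrite -xz in wz.
  by rewrite /nu uE vE wE -xz; exact: ultra.
have nu_close x y : (x < n)%N -> (y < n)%N -> blk x = blk y ->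
    `|D x y - nu x y| <= chi.
  move=> /surj[u [ilt ux _ uE]] /surj[v [_ vy _ vE]] xy.
  have [_ /(Linfty_leP _ _ _ chi0) close] :=
    muP _ (eq_ind_r (fun t => blk x < t)%N ilt sP).
  by rewrite /D /dist_oracle /nu uE vE; apply: close; rewrite // xy.
(* The partners under the given correspondence lie within [delta]; the nearest neighbours are
   compared with them. *)
have near x y : (x < n)%N -> (y < n)%N -> blk y = (blk x).+1 ->
    (exists y', [/\ (y' < n)%N, blk y' = (blk x).+1 & D x y' <= delta]) /\
    (exists x', [/\ (x' < n)%N, blk y = (blk x').+1 & D x' y <= delta]).
  move=> /surj[u [ilt ux xE _]] /surj[v [jlt vy yE _]] xy.
  rewrite xy in jlt vy yE.
  have [[sub totl totr] /(corr_width_leP _ delta0) wid] :=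
    CP _ (eq_ind_r (fun t => (blk x).+1 < t)%N jlt sP).
  split.
    have [v' uv'] := totl _ ux; have := fsubsetP sub _ uv'; rewrite inE /= => /andP[_ v'P].
    exists (pt_number pts (blk x).+1 v'); have [? ? _] := pt_numberP pres jlt v'P.
    split; rewrite ?nE//; rewrite -[D _ _]/(dist_oracle pts x _) -{1}xE.
    by rewrite (dist_oracleE pres)//; exact: wid uv'.
  have [u' u'v] := totr _ vy; have := fsubsetP sub _ u'v; rewrite inE /= => /andP[u'P _].
  exists (pt_number pts (blk x) u'); have [? bE _] := pt_numberP pres ilt u'P.
  split; rewrite ?nE// ?xy ?[blk (pt_number _ _ _)]bE//.
  by rewrite -yE /D (dist_oracleE pres)//; exact: wid u'v.
have [|k a /negbTE kE|k a|k [s [run cost [flags metric]]]] :=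
  @clustering_cmd_wp R n blk D (@dist_oracle_ge0 _ _ pts) (@dist_oracle_sym _ _ pts)
    (@dist_oracle_diag _ _ pts) nu chi nu_sym nu_diag nu_ultra nu_close chi0
    (shape pts) delta (init_state pts) nE tn erefl _ _ _ near.
- by move=> a; rewrite /= size_map.
- by rewrite /= kE.
- by [].
exists k, s; split=> //; first by apply: leq_trans cost _; exact: cmd_cost_poly.
have tableE i x y : out_metric pts s i x y =
    rmem s 0 (pt_number pts i x * n + pt_number pts i y)%N.
  by rewrite /out_metric /cell size_flatten -nE.
split=> i; rewrite sP => ilt.
  have num x : x \in nth fset0 P i ->
      (pt_number pts i x < n)%N /\ blk (pt_number pts i x) = i.
    by move=> /(pt_numberP pres ilt)[? ? _]; rewrite nE.
  have {}metric x y z : x \in nth fset0 P i -> y \in nth fset0 P i ->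
      z \in nth fset0 P i -> let m := out_metric pts s i in
      [/\ 0 <= m x y, m x x = 0, m x y = m y x,
          m x y <= Num.max (m x z) (m z y) & `|mdist x y - m x y| <= chi].
    move=> xP yP zP; rewrite /= !tableE.
    have [[xn xb] [yn yb] [zn zb]] := And3 (num _ xP) (num _ yP) (num _ zP).
    rewrite -(dist_oracleE pres ilt ilt xP yP).
    by apply: metric; rewrite ?xb.
  split; last first.
    by apply/Linfty_leP => // x y xP yP; have [] := metric x y x xP yP xP.
  split; last by move=> x y z xP yP zP; have [] := metric x y z xP yP zP.
  split=> [x y xP yP|x xP|x y xP yP|x y z xP yP zP].
  - by have [] := metric x y x xP yP xP.
  - by have [] := metric x x x xP xP xP.
  - by have [] := metric x y x xP yP xP.
  (* The triangle inequality follows, as the maximum of two nonnegative numbers is at most their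
     sum. *)
  - have [_ _ _ ultra _] := metric x y z xP yP zP; apply: le_trans ultra _.
    have [xz _ _ _ _] := metric x z x xP zP xP.
    have [zy _ _ _ _] := metric z y z zP yP zP.
    by rewrite ge_max lerDl lerDr xz zy.
have ilt' : (i < size pts)%N := ltnW ilt.
have num x : x \in nth fset0 P i ->
    (pt_number pts i x < n)%N /\ blk (pt_number pts i x) = i.
  by move=> /(pt_numberP pres ilt')[? ? _]; rewrite nE.
have numS y : y \in nth fset0 P i.+1 ->
    (pt_number pts i.+1 y < n)%N /\ blk (pt_number pts i.+1 y) = i.+1.
  by move=> /(pt_numberP pres ilt)[? ? _]; rewrite nE.
have in_corr x y : ((x, y) \in out_corr pts P s i) =
    [&& x \in nth fset0 P i, y \in nth fset0 P i.+1 &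
        nmem s 1 (pt_number pts i x * n + pt_number pts i.+1 y)%N != 0%N].
  by rewrite /out_corr !inE /= /cell size_flatten -nE andbA.
(* [flags] speaks of pairs of points in consecutive blocks, so obtaining a partner for one point
   first takes some point of the other block. *)
have Pne j : (j < size pts)%N -> exists x, x \in nth fset0 P j.
  by rewrite -sP => jlt; apply/fset0Pn; case: samp => _; apply; exact: mem_nth.
split; last first.
  apply/corr_width_leP => // -[x y]; rewrite in_corr => /and3P[xP yP fl] /=.
  have [[xn xb] [yn yb]] := conj (num _ xP) (numS _ yP).
  rewrite -(dist_oracleE pres ilt' ilt xP yP).
  by have [|H _ _] := flags _ _ xn yn; [rewrite xb|exact: H].
split.
- apply/fsubsetP => -[x y]; rewrite in_corr inE /= => /and3P[-> -> //].
- move=> x xP; have [y yP] := Pne _ ilt.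
  have [[xn xb] [yn yb]] := conj (num _ xP) (numS _ yP).
  have [|_ [b [bn bb fl]] _] := flags _ _ xn yn; first by rewrite xb.
  have [y' [_ y'P bE _]] := surj _ bn; rewrite bb xb in y'P bE.
  by exists y'; rewrite in_corr xP y'P bE.
- move=> y yP; have [x xP] := Pne _ ilt'.
  have [[xn xb] [yn yb]] := conj (num _ xP) (numS _ yP).
  have [|_ _ [a [an ab fl]]] := flags _ _ xn yn; first by rewrite xb.
  have {}ab : blk a = i by apply/succn_inj; rewrite -ab.
  have [x' [_ x'P aE _]] := surj _ an; rewrite ab in x'P aE.
  by exists x'; rewrite in_corr yP x'P aE.
Qed.
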